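(* Consider parameters $\pi\in(0,\tfrac12)$, $\|\mu\|_2>0$, $\delta>0$ with $\delta<\delta^*(0)$ and such that the optimal margin ratio $\tau^{\rm opt}>0$ exists, and take $\tau=\tau^{\rm opt}$. Then each of the asymptotic test errors $\mathrm{Err}_+^*$, $\mathrm{Err}_-^*$, $\mathrm{Err}_{\rm b}^*$ is a decreasing function of $\pi\in(0,\tfrac12)$, of $\delta$, and of $\|\mu\|_2$ (in each case with the other two parameters fixed).
   Context: Let $(Y,G)$ be independent, $\mathbb P(Y=+1)=\pi=1-\mathbb P(Y=-1)$, $G\sim\mathsf N(0,1)$; $s(+1)=\tau$, $s(-1)=1$; $a_+=\max\{a,0\}$; $\Phi$ the standard normal CDF. Define $$H_\kappa(\rho,\beta_0)=\frac{1-\rho^2}{\mathbb E[(s(Y)\kappa-\rho\|\mu\|_2+G-\beta_0Y)_+^2]},\qquad \delta^*(\kappa)=\max_{\rho\in[-1,1],\,\beta_0\in\mathbb R}H_\kappa(\rho,\beta_0);$$ $\delta^*(0)$ does not depend on $\tau$. For $\delta<\delta^*(0)$ and $\tau\in(0,\infty)$, $(\rho^*,\beta_0^*,\kappa^* )$ denotes the unique solution of: maximize $\kappa$ over $\rho\in[-1,1],\beta_0\in\mathbb R,\kappa\in\mathbb R$ subject to $H_\kappa(\rho,\beta_0)\ge\delta$ ($\rho^*$ does not depend on $\tau$). The asymptotic test errors (limits as $n,d\to\infty$, $n/d\to\delta$ of the test errors of the margin-rebalanced SVM on the Gaussian mixture $\mathbb P(y=+1)=\pi$, $x\mid y\sim\mathsf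 N(y\mu,I_d)$) are $$\mathrm{Err}_+^*=\Phi(-\rho^*\|\mu\|_2-\beta_0^* ),\quad\mathrm{Err}_-^*=\Phi(-\rho^*\|\mu\|_2+\beta_0^* ),\quad\mathrm{Err}_{\rm b}^*=\tfrac12\mathrm{Err}_+^*+\tfrac12\mathrm{Err}_-^*,$$ and $\tau^{\rm opt}$ denotes the value of $\tau\in(0,\infty)$ minimizing $\mathrm{Err}_{\rm b}^*$ (for given $\pi,\|\mu\|_2,\delta$). *)

(* Defs.v *)
From HB Require Import structures.
From mathcomp Require Import all_boot all_order all_algebra.
From mathcomp Require Import all_classical all_reals all_analysis.

Set Implicit Arguments.
Unset Strict Implicit.
Unset Printing Implicit Defensive.

Import Order.TTheory GRing.Theory Num.Theory.
Import numFieldNormedType.Exports.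

Local Open Scope classical_set_scope.
Local Open Scope ring_scope.

(** Conventions: [p] is P(Y = +1) (the name [pi] being taken by the
    trigonometric constant), [beta] is beta_0, [m] is the Euclidean norm of mu
    (the only feature of mu that matters), and a label [b : bool] stands for +1
    ([true]) or -1 ([false]).  The functions below are total; they are
    meaningful for 0 < p < 1, 0 < m, 0 < delta < delta_star p m 1 0 and
    0 < tau. *)

Section MarginRebalancedSVM.
Context {R : realType}.
Implicit Types (p m delta tau kappa rho beta : R).

Definition label (b : bool) : R := if b then 1 else -1.

Definition margin tau (b : bool) : R := if b then tau else 1.

(** The law of (Y, G): independence is the product structure. *)
Definition law_YG p : probability (bool * measurableTypeR R)%type R :=
  (bernoulli_prob p \x normal_prob 0 1)%E.

Definition hinge_sq m tau kappa rho beta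
    (w : bool * measurableTypeR R) : R :=
  Num.max (margin tau w.1 * kappa - rho * m + w.2 - beta * label w.1) 0 ^+ 2.

Definition hinge_risk p m tau kappa rho beta : R :=
  fine ('E_(law_YG p)[hinge_sq m tau kappa rho beta])%E.

Definition H_kappa p m tau kappa rho beta : R :=
  (1 - rho ^+ 2) / hinge_risk p m tau kappa rho beta.

(** The greatest element of [A] (meaningful when it exists). *)
Definition maximum (A : set R) : R := get (A `&` ubound A).

Definition delta_star p m tau kappa : R :=
  maximum [set x | exists rho beta,
    -1 <= rho <= 1 /\ x = H_kappa p m tau kappa rho beta].

Definition feasible p m delta tau (x : R * R * R) : Prop :=
  let: (rho, beta, kappa) := x in
  -1 <= rho <= 1 /\ delta <= H_kappa p m tau kappa rho beta.

Definition is_solution p m delta tau (x : R * R * R) : Prop :=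
  feasible p m delta tau x /\
  forall y, feasible p m delta tau y -> y.2 <= x.2.

Definition solution p m delta tau : R * R * R :=
  get [set x | is_solution p m delta tau x].

Definition rho_star p m delta tau : R := (solution p m delta tau).1.1.

Definition beta_star p m delta tau : R := (solution p m delta tau).1.2.

Definition kappa_star p m delta tau : R := (solution p m delta tau).2.

Definition Phi (x : R) : R := fine (normal_prob 0 1 `]-oo, x]).

Definition Err_plus p m delta tau : R :=
  Phi (- rho_star p m delta tau * m - beta_star p m delta tau).

Definition Err_minus p m delta tau : R :=
  Phi (- rho_star p m delta tau * m + beta_star p m delta tau).

Definition Err_bal p m delta tau : R :=
  2^-1 * Err_plus p m delta tau + 2^-1 * Err_minus p m delta tau.

Definition is_tau_opt p m delta tau : Prop :=
  0 < tau /\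
  forall tau', 0 < tau' -> Err_bal p m delta tau <= Err_bal p m delta tau'.

Definition tau_opt p m delta : R := get [set tau | is_tau_opt p m delta tau].

(** [delta_star p m tau 0] does not depend on [tau], since the margins are
    multiplied by [kappa = 0]; it is taken here at [tau = 1]. *)
Definition admissible p m delta : Prop :=
  [/\ 0 < p < 2^-1, 0 < m, 0 < delta, delta < delta_star p m 1 0
    & exists tau, is_tau_opt p m delta tau].

Definition Err_plus_opt p m delta : R :=
  Err_plus p m delta (tau_opt p m delta).

Definition Err_minus_opt p m delta : R :=
  Err_minus p m delta (tau_opt p m delta).

Definition Err_bal_opt p m delta : R :=
  Err_bal p m delta (tau_opt p m delta).

Definition decreasing_on (A : set R) (f : R -> R) : Prop :=
  forall x y, A x -> A y -> x < y -> f y < f x.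

(** [E p m delta] decreases strictly in each of its three arguments. *)
Definition decreasing_in_each (E : R -> R -> R -> R) : Prop :=
  [/\ forall m delta,
        decreasing_on [set p | admissible p m delta] (fun p => E p m delta),
      forall p m,
        decreasing_on [set delta | admissible p m delta] (fun delta => E p m delta)
    & forall p delta,
        decreasing_on [set m | admissible p m delta] (fun m => E p m delta)].

End MarginRebalancedSVM.

(* Main.v *)
From HB Require Import structures.
Require Import Defs.
From mathcomp Require Import all_boot all_order all_algebra.
From mathcomp Require Import all_classical all_reals all_analysis.
From mathcomp Require Import measurable_realfun ring lra.

(** In the variables [a = tau * kappa - rho * m - beta] and
    [b = kappa - rho * m + beta] one has [(1 + tau) * kappa = a + b + 2 * rho * m],
    so maximizing [kappa] is a strictly concave problem in [(rho, a, b)] that no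
    longer involves [tau]; only [beta] depends on [tau], and sweeps an open
    interval.  As the balanced error is even and increasing in [`|beta|], an
    optimal [tau] makes [beta = 0], and the three errors equal [Phi (- rho * m)].

    Writing [g x = E (x + G)_+] and [h = (fun x => E (x + G)_+ ^+ 2) \o g^-1],
    the optimality conditions reduce to
    [delta * (p * h (t / p) + (1 - p) * h (t / (1 - p))) + rho ^+ 2 = 1] with
    [t = rho / (2 * delta * m)].  By log-concavity of [g], [h] is strictly convex
    (and [h 0+ = 0]), so for fixed [rho] the left-hand side decreases in [p] (on
    [p < 1 / 2]) and in [delta], and for fixed [rho * m] it decreases in [m], while
    it increases in [rho]: hence [rho * m] increases in each parameter. *)

Set Implicit Arguments.
Unset Strict Implicit.
Unset Printing Implicit Defensive.

Import Order.TTheory GRing.Theory Num.Theory.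
Import numFieldNormedType.Exports.

Local Open Scope classical_set_scope.
Local Open Scope ring_scope.

(** * Monotonicity from the derivative, and positivity from the behaviour at [-oo] *)

Section Monotonicity.
Context {R : realType}.
Implicit Types (f df : R -> R).

Lemma derive_gt0_lt f df (x y : R) : x < y ->
  (forall z, x <= z <= y -> is_derive z 1 f (df z)) ->
  (forall z, x < z < y -> 0 < df z) -> f x < f y.
Proof.
move=> xy fdf df0; apply: (@gtr0_derive1_lt_cc _ f x y) => //.
- move=> z; rewrite in_itv/= => /andP[xz zy].
  by have [] := fdf z; rewrite ?ltW.
- move=> z; rewrite in_itv/= => /andP[xz zy].
  have H : is_derive z 1 f (df z) by apply: fdf; rewrite !ltW.
  by rewrite derive1E derive_val df0 // xz.
- apply: derivable_within_continuous => z; rewrite in_itv/= => zxy.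
  by have [] := fdf z zxy.
- by rewrite in_itv/= lexx ltW.
- by rewrite in_itv/= lexx ltW.
Qed.

Lemma gt0_of_incr_cvgNy f (c : R) :
  (forall x y, x < y -> y < c -> f x < f y) ->
  (forall e, 0 < e -> \forall y \near -oo, - e < f y) ->
  forall x, x < c -> 0 < f x.
Proof.
move=> fincr flim x xc; rewrite ltNge; apply/negP => fx0.
have f1 : f (x - 1) < f x by apply: fincr => //; rewrite ltrBlDr ltrDl.
have e0 : 0 < - f (x - 1) by rewrite oppr_gt0 (lt_le_trans f1).
have : \forall y \near -oo, f (x - 1) < f y /\ y < x - 1.
  near=> y; split; last by near: y; apply: nbhs_ninfty_lt; exact: num_real.
  by rewrite -[ltLHS]opprK; near: y; exact: flim.
move=> /filter_ex[y [fy yx]].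
have y1c : x - 1 < c by rewrite (lt_trans _ xc)// ltrBlDr ltrDl.
by have := lt_trans (fincr _ _ yx y1c) fy; rewrite ltxx.
Unshelve. all: by end_near. Qed.

End Monotonicity.

(** * The normal density and CDF: derivatives and tails *)

Section Gaussian.
Context {R : realType}.
Implicit Types x t : R.
Local Notation mu := lebesgue_measure.
Local Notation phi := (normal_pdf (0 : R) 1).

Lemma phiE x : phi x = normal_peak 1 * expR (- (x ^+ 2 / 2)).
Proof.
rewrite normal_pdfE ?oner_neq0// /normal_fun subr0 expr1n mulNr.
by rewrite mulr2n.
Qed.

Lemma phi_gt0 x : 0 < phi x.
Proof. by rewrite phiE mulr_gt0 ?expR_gt0// normal_peak_gt0// oner_neq0. Qed.

Lemma phiN x : phi (- x) = phi x.
Proof. by rewrite !phiE sqrrN. Qed.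

Lemma is_derive_phi x : is_derive x 1 phi (- x * phi x).
Proof.
rewrite [X in is_derive _ _ X _](_ : _ =
  (fun x => normal_peak 1 * expR (- (x ^+ 2 / 2)))); last first.
  by apply/funext => y; exact: phiE.
apply: is_derive_eq.
rewrite phiE /=. rewrite /GRing.scale /= !mulr1.
by field.
Qed.

Lemma is_derive_Phi x : is_derive x 1 (@Phi R) (phi x).
Proof.
have /= := @continuous_FTC1 R phi -oo%O x (x + 1).
rewrite ltrDl ltr01 => /(_ erefl).
have intf : mu.-integrable `]-oo, (x + 1)] (EFin \o phi).
  apply: (integrableS measurableT) => //.
  exact: (integrable_normal_pdf 0 1).
move=> /(_ intf); rewrite ltNyr => /(_ erefl).
move=> /(_ (continuous_normal_pdf (oner_neq0 _) (x := x))) [dF FE].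
apply: DeriveDef; first exact: dF.
by rewrite -derive1E; exact: FE.
Qed.

Lemma Phi_incr x t : x < t -> Phi x < Phi t.
Proof.
move=> xt; apply: (@derive_gt0_lt _ _ phi) => // z _.
  exact: is_derive_Phi.
exact: phi_gt0.
Qed.

Lemma Phi_ge0 x : 0 <= @Phi R x.
Proof. by rewrite /Phi fine_ge0. Qed.

Lemma Phi_gt0 x : 0 < Phi x.
Proof. by rewrite (le_lt_trans (Phi_ge0 (x - 1)))// Phi_incr// ltrBlDr ltrDl. Qed.

(** The identity seen as a random variable: under the normal law its CDF is [Phi], so the general
    limit of a CDF at [-oo] applies. *)
Let idTR : measurableTypeR R -> R := idfun.

#[local] HB.instance Definition _ :=
  @isMeasurableFun.Build _ _ _ _ idTR (@measurable_id _ _ setT).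

Lemma cvg_PhiNy : Phi y @[y --> -oo] --> (0 : R).
Proof.
have /fine_cvgP[_] := @cvg_cdfNy0 _ _ R (normal_prob 0 1) idTR.
exact.
Qed.

(** Follows from [expR u >= 1 + u] at [u = x ^+ 2 / 2]; this crude bound suffices for both tail
    limits below. *)
Lemma phi_bound x : 0 < x -> x * phi x <= 2 * normal_peak 1 / x.
Proof.
move=> x0; rewrite phiE mulrCA [leRHS]mulrAC [leRHS]mulrC ler_wpM2l ?normal_peak_ge0//.
rewrite expRN ler_pdivrMr ?expR_gt0//.
have h := expR_ge1Dx (x ^+ 2 / 2).
by rewrite mulrAC ler_pdivlMr// -expr2; nra.
Qed.

Lemma cvg_Mphi : x * phi x @[x --> +oo] --> (0 : R).
Proof.
apply: (@squeeze_cvgr _ _ _ _ (cst 0) (fun x => 2 * normal_peak 1 * x^-1)).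
- near=> x.
  have x0 : 0 < x by near: x; apply: nbhs_pinfty_gt; exact: num_real.
  by rewrite phi_bound// mulr_ge0 ?normal_pdf_ge0 ?ltW.
- exact: cvg_cst.
- rewrite -(mulr0 (2 * normal_peak 1)); apply: cvgMr.
  apply/gtr0_cvgV0; last exact: cvg_id.
  by near=> x; near: x; apply: nbhs_pinfty_gt; exact: num_real.
Unshelve. all: by end_near. Qed.

Lemma cvg_phi : phi x @[x --> +oo] --> (0 : R).
Proof.
apply: (@squeeze_cvgr _ _ _ _ (cst 0) (fun x => x * phi x)).
- near=> x.
  have x1 : 1 < x by near: x; apply: nbhs_pinfty_gt; exact: num_real.
  by rewrite normal_pdf_ge0/= ler_peMl ?normal_pdf_ge0// ltW.
- exact: cvg_cst.
- exact: cvg_Mphi.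
Unshelve. all: by end_near. Qed.

End Gaussian.

Lemma derive_sign_lt {R : realType} (f df : R -> R) (x y : R) :
  (forall z : R, is_derive z 1 f (df z)) ->
  (forall z, z < x -> df z < 0) -> (forall z, x < z -> 0 < df z) ->
  y != x -> f x < f y.
Proof.
move=> fdf dfN dfP; rewrite neq_lt => /orP[yx|xy].
  rewrite -ltrN2; apply: (@derive_gt0_lt _ (fun t => - f t) (fun t => - df t)) => //.
  by move=> z /andP[_ zx]; rewrite oppr_gt0 dfN.
by apply: (derive_gt0_lt xy) => // z /andP[xz _]; exact: dfP.
Qed.

(** * Truncated Gaussian moments: positivity, convexity, inverse *)

Section HingeMoments.
Context {R : realType}.
Implicit Types x y t e : R.
Local Notation phi := (normal_pdf (0 : R) 1).

(** [hinge1 x] and [hinge2 x] are the expectations of [(x + G)_+] and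
    [(x + G)_+ ^+ 2] for a standard normal [G]. *)
Definition hinge1 x : R := x * Phi x + phi x.

Definition hinge2 x : R := (1 + x ^+ 2) * Phi x + x * phi x.

#[local] Existing Instance is_derive_phi.
#[local] Existing Instance is_derive_Phi.

#[local] Instance is_derive_hinge1 x : is_derive x 1 hinge1 (Phi x).
Proof.
by apply: is_derive_eq; rewrite /GRing.scale /=; ring.
Qed.

#[local] Instance is_derive_hinge2 x : is_derive x 1 hinge2 (2 * hinge1 x).
Proof.
by apply: is_derive_eq; rewrite /hinge1 /GRing.scale /=; ring.
Qed.

Lemma near_ltNy (c : R) : \forall y \near -oo, y < c.
Proof. by apply: nbhs_ninfty_lt; exact: num_real. Qed.

Lemma near_Phi_lt e : 0 < e -> \forall y \near -oo, Phi y < e.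
Proof. by move=> e0; apply: (cvgr_lt _ (@cvg_PhiNy R)). Qed.

Lemma near_phi_lt e : 0 < e -> \forall y \near -oo, phi y < e.
Proof.
move=> e0; apply: (cvgr_lt 0) => //; apply/cvgNy_compNP.
rewrite [X in X @ _ --> _](_ : _ = phi); first exact: cvg_phi.
by apply/funext => x; exact: phiN.
Qed.

Lemma near_Mphi_lt e : 0 < e -> \forall y \near -oo, - e < y * phi y.
Proof.
move=> e0; suff : \forall y \near -oo, - (y * phi y) < e.
  by apply: filterS => y; rewrite ltrNl.
apply: (cvgr_lt 0) => //; apply/cvgNy_compNP.
rewrite [X in X @ _ --> _](_ : _ = (fun y => y * phi y)); first exact: cvg_Mphi.
by apply/funext => x /=; rewrite phiN mulNr opprK.
Qed.

(** Mills ratio: [- phi x / x - Phi x] is increasing and vanishes at [-oo]. *)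
Lemma hinge1_gt0 x : 0 < hinge1 x.
Proof.
have [x0|x0] := leP 0 x.
  by rewrite ltr_wpDl ?phi_gt0// mulr_ge0// Phi_ge0.
suff : 0 < - (phi x * x^-1) - Phi x.
  rewrite subr_gt0 -mulrN -invrN ltr_pdivlMr ?oppr_gt0// mulrN /hinge1; lra.
pose f (y : R) := - (phi y * y^-1) - Phi y.
apply: (@gt0_of_incr_cvgNy _ f 0) => //.
  move=> y z yz z0.
  apply: (@derive_gt0_lt _ f (fun y => phi y / y ^+ 2)) => //; last first.
    by move=> t /andP[_ tz]; rewrite divr_gt0 ?phi_gt0// exprn_even_gt0//= lt_eqF// (lt_trans tz).
  move=> t /andP[_ tz].
  have t0 : t != 0 by rewrite lt_eqF// (le_lt_trans tz).
  have H := @is_deriveV _ id t 1 1 t0 _.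
  apply: is_derive_eq; rewrite /GRing.scale /=.
  by field.
move=> e e0; near=> y.
have y0 : y < 0 by near: y; exact: near_ltNy.
have Pe : Phi y < e by near: y; exact: near_Phi_lt.
suff : 0 < - (phi y * y^-1) by rewrite /f; lra.
by rewrite -mulrN -invrN divr_gt0 ?phi_gt0// oppr_gt0.
Unshelve. all: by end_near. Qed.

Lemma hinge1_incr x y : x < y -> hinge1 x < hinge1 y.
Proof.
move=> xy; apply: (@derive_gt0_lt _ hinge1 Phi) => // z _; exact: Phi_gt0.
Qed.

Lemma hinge1_lt x y : (hinge1 x < hinge1 y) = (x < y).
Proof. exact: (leW_mono (le_mono hinge1_incr)). Qed.

Lemma hinge1_le x y : (hinge1 x <= hinge1 y) = (x <= y).
Proof. exact: (le_mono hinge1_incr). Qed.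

Lemma hinge1_inj : injective hinge1.
Proof. exact: (inc_inj (le_mono hinge1_incr)). Qed.

Lemma hinge1_lt_phi x : x < 0 -> hinge1 x < phi x.
Proof. by move=> x0; rewrite /hinge1 gtrDr nmulr_rlt0// Phi_gt0. Qed.

Lemma near_hinge1_lt e : 0 < e -> \forall y \near -oo, hinge1 y < e.
Proof.
move=> e0; near=> y; apply: (@lt_trans _ _ (phi y)); last first.
  by near: y; exact: near_phi_lt.
by apply: hinge1_lt_phi; near: y; exact: near_ltNy.
Unshelve. all: by end_near. Qed.

Lemma hinge2_incr x y : x < y -> hinge2 x < hinge2 y.
Proof.
move=> xy; apply: (@derive_gt0_lt _ hinge2 (fun x => 2 * hinge1 x)) => // z _.
by rewrite mulr_gt0 ?hinge1_gt0.
Qed.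

Lemma hinge2_le x y : (hinge2 x <= hinge2 y) = (x <= y).
Proof. exact: (le_mono hinge2_incr). Qed.

Lemma hinge2E x : hinge2 x = Phi x + x * hinge1 x.
Proof. by rewrite /hinge2 /hinge1; ring. Qed.

Lemma hinge2_gt0 x : 0 < hinge2 x.
Proof.
apply: (@gt0_of_incr_cvgNy _ hinge2 (x + 1)); last by rewrite ltrDl.
  by move=> y z yz _; exact: hinge2_incr.
move=> e e0; near=> y.
have y0 : y < 0 by near: y; exact: near_ltNy.
have ye : - e < y * phi y by near: y; exact: near_Mphi_lt.
(* For [y < 0], [hinge1 y < phi y] gives [Phi y + y * hinge1 y > y * phi y > - e]. *)
have := hinge1_lt_phi y0; have := Phi_gt0 y; rewrite hinge2E; nra.
Unshelve. all: by end_near. Qed.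

Lemma near_hinge2_lt e : 0 < e -> \forall y \near -oo, hinge2 y < e.
Proof.
move=> e0; near=> y.
have y0 : y < 0 by near: y; exact: near_ltNy.
have Pe : Phi y < e by near: y; exact: near_Phi_lt.
have := hinge1_gt0 y; rewrite hinge2E; nra.
Unshelve. all: by end_near. Qed.

(** Strict log-concavity of [hinge1]. *)
Lemma hinge1_phi_lt x : hinge1 x * phi x < Phi x ^+ 2.
Proof.
pose f y := Phi y ^+ 2 * (phi y)^-1 - hinge1 y.
suff : 0 < f x by rewrite subr_gt0 ltr_pdivlMr ?phi_gt0.
apply: (@gt0_of_incr_cvgNy _ f (x + 1)); last by rewrite ltrDl.
  move=> y z yz _.
  apply: (@derive_gt0_lt _ f (fun y => Phi y * hinge1 y / phi y)) => //.
    move=> t _; have t0 : phi t != 0 by rewrite gt_eqF// phi_gt0.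
    have H := @is_deriveV _ phi t 1 _ t0 _.
    apply: is_derive_eq; rewrite /GRing.scale /= /hinge1.
    by field.
  by move=> t _; rewrite divr_gt0 ?mulr_gt0 ?phi_gt0 ?Phi_gt0 ?hinge1_gt0.
move=> e e0; near=> y.
have ge : hinge1 y < e by near: y; exact: near_hinge1_lt.
suff : 0 < Phi y ^+ 2 * (phi y)^-1 by rewrite /f; lra.
by rewrite divr_gt0 ?phi_gt0// exprn_gt0// Phi_gt0.
Unshelve. all: by end_near. Qed.

(** With [h := hinge2 \o hinge1^-1], the slope of [h] at [hinge1 x] is [2 * hinge1 x / Phi x], so
    this is the strict convexity of [h]; it rests on the log-concavity of [hinge1]. *)
Lemma hinge1_div_Phi_incr x y : x < y -> hinge1 x / Phi x < hinge1 y / Phi y.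
Proof.
move=> xy; apply: (@derive_gt0_lt _ (fun x => hinge1 x * (Phi x)^-1)
   (fun x => (Phi x ^+ 2 - hinge1 x * phi x) / Phi x ^+ 2)) => // t _.
  have t0 : Phi t != 0 :> R by rewrite gt_eqF// Phi_gt0.
  have H := @is_deriveV _ Phi t 1 _ t0 _.
  apply: is_derive_eq; rewrite /GRing.scale /= /hinge1.
  by field.
by rewrite divr_gt0 ?exprn_gt0 ?Phi_gt0// subr_gt0 hinge1_phi_lt.
Qed.

(** With [h := hinge2 \o hinge1^-1] and [t := hinge1 x], this is
    [t * h'(t) - h(t)], the Legendre transform of the convex function [h]. *)
Definition hinge_dual x : R := 2 * hinge1 x ^+ 2 / Phi x - hinge2 x.

Lemma hinge_dual_incr x y : x < y -> hinge_dual x < hinge_dual y.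
Proof.
move=> xy; apply: (@derive_gt0_lt _ hinge_dual
   (fun x => 2 * hinge1 x * (Phi x ^+ 2 - hinge1 x * phi x) / Phi x ^+ 2) _ _ xy) => t _.
  have t0 : Phi t != 0 :> R by rewrite gt_eqF// Phi_gt0.
  have H := @is_deriveV _ Phi t 1 _ t0 _.
  apply: is_derive_eq; rewrite /GRing.scale /= /hinge1.
  by field.
rewrite divr_gt0 ?exprn_gt0 ?Phi_gt0// mulr_gt0 ?subr_gt0 ?hinge1_phi_lt//.
by rewrite mulr_gt0// hinge1_gt0.
Qed.

Lemma hinge_dual_gt0 x : 0 < hinge_dual x.
Proof.
apply: (@gt0_of_incr_cvgNy _ _ (x + 1)); last by rewrite ltrDl.
  by move=> y z yz _; exact: hinge_dual_incr.
move=> e e0; near=> y.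
have ge : hinge2 y < e by near: y; exact: near_hinge2_lt.
suff : 0 < 2 * hinge1 y ^+ 2 / Phi y by rewrite /hinge_dual; lra.
by rewrite divr_gt0 ?Phi_gt0// mulr_gt0// exprn_gt0// hinge1_gt0.
Unshelve. all: by end_near. Qed.

(** This is the growth of [h t / t], whose derivative [(t * h' t - h t) / t ^+ 2] has the positive
    [hinge_dual] as numerator. *)
Lemma hinge2_div_hinge1_incr x y : x < y ->
  hinge2 x / hinge1 x < hinge2 y / hinge1 y.
Proof.
move=> xy; apply: (@derive_gt0_lt _ (fun x => hinge2 x * (hinge1 x)^-1)
   (fun x => hinge_dual x * Phi x / hinge1 x ^+ 2)) => // t _.
  have t0 : hinge1 t != 0 by rewrite gt_eqF// hinge1_gt0.
  have t1 : Phi t != 0 :> R by rewrite gt_eqF// Phi_gt0.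
  have H := @is_deriveV _ hinge1 t 1 _ t0 _.
  apply: is_derive_eq; rewrite /GRing.scale /= /hinge_dual.
  by field; rewrite t0.
by rewrite divr_gt0 ?exprn_gt0 ?hinge1_gt0// mulr_gt0// ?hinge_dual_gt0// Phi_gt0.
Qed.

Lemma hinge2_gradient x y : y != x ->
  hinge2 x + 2 * hinge1 x * (y - x) < hinge2 y.
Proof.
move=> yx; pose f z := hinge2 z - 2 * hinge1 x * z.
suff : f x < f y by rewrite /f; lra.
apply: (@derive_sign_lt _ f (fun z => 2 * hinge1 z - 2 * hinge1 x)) => //.
- by move=> z; apply: is_derive_eq; rewrite /GRing.scale /=; ring.
- by move=> z /hinge1_incr; lra.
- by move=> z /hinge1_incr; lra.
Qed.

(** The strict supporting line of [h] in the variable [t = hinge1 x], whereas [hinge2_gradient] is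
    that of [hinge2] in [x]. *)
Lemma hinge2_tangent x y : y != x ->
  hinge2 x + 2 * hinge1 x / Phi x * (hinge1 y - hinge1 x) < hinge2 y.
Proof.
move=> yx; pose r := 2 * hinge1 x / Phi x; pose f z := hinge2 z - r * hinge1 z.
suff : f x < f y by rewrite /f /r; lra.
have Er (z : R) : 2 * hinge1 z - r * Phi z
    = 2 * Phi z * (hinge1 z / Phi z - hinge1 x / Phi x).
  by rewrite /r; field; rewrite !gt_eqF ?Phi_gt0.
apply: (@derive_sign_lt _ f (fun z => 2 * hinge1 z - r * Phi z)) => //.
- move=> z /hinge1_div_Phi_incr zx.
  by rewrite Er nmulr_llt0 ?mulr_gt0 ?Phi_gt0// subr_lt0.
- move=> z /hinge1_div_Phi_incr zx.
  by rewrite Er mulr_gt0 ?mulr_gt0 ?Phi_gt0// subr_gt0.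
Qed.

Lemma continuous_hinge1 : continuous hinge1.
Proof.
move=> x; apply/differentiable_continuous/derivable1_diffP.
by case: (is_derive_hinge1 x).
Qed.

Lemma continuous_hinge2 : continuous hinge2.
Proof.
move=> x; apply/differentiable_continuous/derivable1_diffP.
by case: (is_derive_hinge2 x).
Qed.

Lemma hinge1_surj t : 0 < t -> exists x, hinge1 x = t.
Proof.
move=> t0; have /filter_ex[a at_] := near_hinge1_lt t0.
(* As [b >= 0], [hinge1 b >= b * Phi b >= b * Phi 0 >= t]. *)
pose b := Num.max a (t / Phi 0).
have b0 : 0 <= b by rewrite le_max divr_ge0 ?Phi_ge0 ?orbT// ltW.
have tb : t <= hinge1 b.
  rewrite /hinge1 (le_trans _ (_ : b * Phi 0 <= _))//.
    by rewrite -ler_pdivrMr ?Phi_gt0// le_max lexx orbT.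
  rewrite ler_wpDr ?normal_pdf_ge0// ler_wpM2l//.
  by move: b0; rewrite le_eqVlt => /predU1P[<-//|/Phi_incr/ltW].
have ab : a <= b by rewrite le_max lexx.
have [] := @IVT R hinge1 a b t ab.
- by apply: continuous_subspaceT; exact: continuous_hinge1.
- by rewrite ge_min (ltW at_)/= le_max tb orbT.
by move=> c _ <-; exists c.
Qed.

(** The default [0] is taken exactly when [t <= 0], outside the range of [hinge1]. *)
Definition hinge1_inv t : R := xget 0 [set x | hinge1 x = t].

Lemma hinge1_invK t : 0 < t -> hinge1 (hinge1_inv t) = t.
Proof. by move=> /hinge1_surj[x xt]; rewrite /hinge1_inv; case: xgetP => //= /(_ x). Qed.

Lemma hinge1K : cancel hinge1 hinge1_inv.
Proof. by move=> x; apply: hinge1_inj; rewrite hinge1_invK// hinge1_gt0. Qed.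

Lemma continuous_hinge1_inv t : 0 < t -> {for t, continuous hinge1_inv}.
Proof.
move=> /hinge1_surj[x <-].
apply: nbhs_singleton (near_can_continuous _ _).
  by near=> z; exact: hinge1K.
by near=> z; exact: continuous_hinge1.
Unshelve. all: by end_near. Qed.

End HingeMoments.

(** * Integration against the normal law through its density *)

Section NormalIntegral.
Context {R : realType} (m s : R).
Local Notation mu := lebesgue_measure.
Local Notation pdf := (normal_pdf m s).

Let pdf_ge0 x : (0 <= (pdf x)%:E)%E.
Proof. by rewrite lee_fin normal_pdf_ge0. Qed.

Let measurable_pdf : measurable_fun setT (fun x : measurableTypeR R => (pdf x)%:E).
Proof. by apply/measurable_EFinP; exact: measurable_normal_pdf. Qed.

Import HBNNSimple.

Let integral_normal_indic (E : set (measurableTypeR R)) : measurable E ->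
  (\int[normal_prob m s]_x (\1_E x)%:E = \int[mu]_x ((\1_E x)%:E * (pdf x)%:E))%E.
Proof.
move=> mE; rewrite integral_indic// setIT.
transitivity (\int[mu]_(x in E) (pdf x)%:E)%E => //.
rewrite [LHS]integral_mkcond.
apply: eq_integral => x _; rewrite patchE indicE.
by case: ifPn => xE; rewrite ?mul1e ?mul0e.
Qed.

Let integral_normal_nnsfun (f : {nnsfun (measurableTypeR R) >-> R}) :
  (\int[normal_prob m s]_x (f x)%:E = \int[mu]_x ((f x)%:E * (pdf x)%:E))%E.
Proof.
under [LHS]eq_integral do rewrite fimfunE -fsumEFin//.
rewrite [LHS]ge0_integral_fsum//; last 2 first.
  - by move=> r; exact/measurable_EFinP/measurableT_comp.
  - by move=> n x _; rewrite EFinM nnfun_muleindic_ge0.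
under [RHS]eq_integral.
  move=> x xD; rewrite fimfunE -fsumEFin// ge0_mule_fsuml; last first.
    by move=> r; rewrite EFinM nnfun_muleindic_ge0.
  over.
rewrite [RHS]ge0_integral_fsum//; last 2 first.
  - move=> r; apply: emeasurable_funM => //.
    by apply/measurable_EFinP; do 2 apply/measurableT_comp => //.
  - by move=> n x _; rewrite EFinM mule_ge0// nnfun_muleindic_ge0.
apply: eq_fsbigr => r _.
under [RHS]eq_integral do rewrite EFinM -muleA.
have [r0|r0] := leP 0 r.
  rewrite integralZl_indic_nnsfun//= integral_normal_indic//.
  rewrite ge0_integralZl//.
  - apply: emeasurable_funM => //.
    by apply/measurable_EFinP/measurable_indic.
  - by move=> x _; rewrite mule_ge0// lee_fin.
(* For [r < 0] the level set of a nonnegative function is empty and both sides vanish. *)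
rewrite preimage_nnfun0//.
rewrite !integral0_eq// => x _; by rewrite indic0 ?mul0e ?mule0 ?mulr0.
Qed.

(** Indicators first, then simple functions by linearity, then monotone convergence along
    [nnsfun_approx]. *)
Lemma integral_normal_prob (f : measurableTypeR R -> \bar R) :
  measurable_fun setT f -> (forall x, 0 <= f x)%E ->
  (\int[normal_prob m s]_x f x = \int[mu]_x (f x * (pdf x)%:E))%E.
Proof.
move=> mf f0.
pose f_ := nnsfun_approx measurableT mf.
transitivity (lim (\int[normal_prob m s]_x (f_ n x)%:E @[n --> \oo])%E).
  rewrite -monotone_convergence//=.
  - apply: eq_integral => ? /[!inE] xD; apply/esym/cvg_lim => //=.
    exact: cvg_nnsfun_approx.
  - by move=> n; exact/measurable_EFinP/measurable_funTS.
  - by move=> n ? _; rewrite lee_fin.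
  - by move=> ? _ ? ? mn; rewrite lee_fin; exact/lefP/nd_nnsfun_approx.
under eq_fun do rewrite integral_normal_nnsfun.
rewrite -monotone_convergence//=.
- apply: eq_integral => x _; apply/cvg_lim => //=.
  apply: cvgeZr => //.
  exact: cvg_nnsfun_approx.
- move=> n; apply: emeasurable_funM => //.
  by exact/measurable_EFinP/measurable_funTS.
- by move=> n x _; rewrite mule_ge0// lee_fin.
- move=> x _ a b ab; rewrite lee_wpmul2r// lee_fin.
  exact/lefP/nd_nnsfun_approx.
Qed.

End NormalIntegral.

(** * Closed form of the hinge risk *)

Section HingeRisk.
Context {R : realType}.
Local Notation mu := lebesgue_measure.
Local Notation phi := (normal_pdf (0 : R) 1).
#[local] Existing Instance is_derive_phi.
#[local] Existing Instance is_derive_Phi.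

Lemma measurable_hinge (x : R) :
  measurable_fun setT (fun t : measurableTypeR R => Num.max (x + t) 0 ^+ 2).
Proof.
apply: measurable_funX; apply: measurable_maxr => //.
by apply: measurable_funD => //.
Qed.

Lemma integral_hinge2 (x : R) :
  (\int[normal_prob 0 1]_t (Num.max (x + t) 0 ^+ 2)%:E = (hinge2 x)%:E)%E.
Proof.
rewrite integral_normal_prob//; last 2 first.
- by apply/measurable_EFinP; exact: measurable_hinge.
- by move=> t; rewrite lee_fin sqr_ge0.
transitivity (\int[mu]_(t in `[(- x)%R, +oo[) ((x + t) ^+ 2 * phi t)%:E)%E.
  rewrite [RHS]integral_mkcond; apply: eq_integral => t _.
  rewrite patchE; case: ifPn; rewrite ?inE ?notin_setE/= in_itv/= andbT => xt.
    by rewrite max_l// -lerBlDl sub0r.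
  rewrite max_r ?expr0n ?mul0e//.
  by move/negP: xt; rewrite -ltNge; lra.
(* An antiderivative of [(x + t) ^+ 2 * phi t], written with [Phi (- t)] so that it vanishes at
   [+oo]; the integral is then [- F (- x) = hinge2 x]. *)
pose F t := - (1 + x ^+ 2) * Phi (- t) - (2 * x + t) * phi t.
have dF (t : R) : is_derive t 1 F ((x + t) ^+ 2 * phi t).
  have H : is_derive t 1 (fun t => Phi (- t) : R) (- phi t).
    have := @is_derive1_comp R (@Phi R) (fun t => - t) t (phi (- t)) (- 1) (is_derive_Phi _) _.
    by rewrite phiN mulrN1; apply; exact: is_deriveNid.
  by apply: is_derive_eq; rewrite /GRing.scale /=; ring.
have cont (f : R -> R) df (t : R) : is_derive t 1 f df -> {for t, continuous f}.
  by case=> ? _; apply/differentiable_continuous/derivable1_diffP.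
rewrite (@ge0_continuous_FTC2y _ _ F _ 0).
- rewrite sub0e -EFinN /F /hinge2 opprK phiN; congr EFin; ring.
- by move=> t _; rewrite mulr_ge0 ?sqr_ge0 ?normal_pdf_ge0.
- apply: continuous_subspaceT => t.
  by apply: cont; apply: is_derive_eq.
- rewrite -[0](_ : - (1 + x ^+ 2) * 0 - (2 * x * 0 + 0) = 0); last by ring.
  apply: cvgB.
    by apply: cvgMr; have := @cvg_PhiNy R; rewrite cvgNy_compNP.
  rewrite [X in X @ _ --> _](_ : _ = (fun t => 2 * x * phi t + t * phi t)); last first.
    by apply/funext => t /=; rewrite mulrDl.
  by apply: cvgD; [apply: cvgMr; exact: cvg_phi|exact: cvg_Mphi].
- by move=> t _; case: (dF t).
- apply: cvg_at_right_filter; exact: cont (dF _).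
- by move=> t _; have := dF t => H; rewrite derive1E derive_val.
Qed.

Lemma hinge_riskE (p m tau kappa rho beta : R) : 0 <= p <= 1 ->
  hinge_risk p m tau kappa rho beta =
    p * hinge2 (tau * kappa - rho * m - beta)
    + (1 - p) * hinge2 (kappa - rho * m + beta).
Proof.
move=> p01; rewrite /hinge_risk unlock /law_YG.
have mh : measurable_fun setT (fun w => (hinge_sq m tau kappa rho beta w)%:E).
  apply/measurable_EFinP; apply: measurable_funX; apply: measurable_maxr => //.
  have mfst (f : bool -> R) :
      measurable_fun setT (fun w : bool * measurableTypeR R => f w.1).
    by apply: (measurableT_comp _ measurable_fst) => _ Y _.
  apply: measurable_funB; last exact: (mfst (fun b => beta * label b)).
  apply: measurable_funD; last exact: measurable_snd.
  exact: (mfst (fun b => margin tau b * kappa - rho * m)).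
rewrite fubini_tonelli1//; last by move=> w; rewrite lee_fin sqr_ge0.
rewrite integral_bernoulli_prob//; last first.
  by move=> b; apply: integral_ge0 => t _; rewrite lee_fin sqr_ge0.
rewrite /fubini_F /hinge_sq /=.
under eq_integral do rewrite mulr1 addrAC.
rewrite integral_hinge2.
under eq_integral do rewrite mul1r mulrN1 opprK addrAC.
by rewrite integral_hinge2 -!EFinM -EFinD.
Qed.

End HingeRisk.

(** * The KKT system and the margin maximization problem *)

Section Optimum.
Context {R : realType}.
Local Notation phi := (normal_pdf (0 : R) 1).
Implicit Types p m delta tau kappa rho beta a b : R.

Definition mean_hinge2 p a b : R := p * hinge2 a + (1 - p) * hinge2 b.

(** The Karush-Kuhn-Tucker system, multiplier eliminated, of: maximize
    [a + b + 2 * rho * m] subject to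
    [delta * mean_hinge2 p a b <= 1 - rho ^+ 2]. *)
Definition kkt p m delta rho a b : Prop :=
  [/\ 0 < rho,
      2 * delta * m * (p * hinge1 a) = rho,
      2 * delta * m * ((1 - p) * hinge1 b) = rho
    & delta * mean_hinge2 p a b + rho ^+ 2 = 1].

Lemma mean_hinge2_gt0 p a b : 0 < p < 1 -> 0 < mean_hinge2 p a b.
Proof.
move=> /andP[p0 p1].
by rewrite addr_gt0// mulr_gt0 ?hinge2_gt0// subr_gt0.
Qed.

(** For given [rho = r > 0] the two gradient equations determine [a = A r] and [b = B r]; the
    constraint [T r = 1] is then solved by the intermediate value theorem. *)
Lemma kkt_exists p m delta : 0 < p < 1 -> 0 < m -> 0 < delta ->
  exists rho a b, kkt p m delta rho a b.
Proof.
move=> p01 m0 d0; have [p0 p1] := andP p01.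
have q0 : 0 < 1 - p by rewrite subr_gt0.
have c0 : 0 < 2 * delta * m by rewrite !mulr_gt0.
pose A r := hinge1_inv (r / (2 * delta * m * p)).
pose B r := hinge1_inv (r / (2 * delta * m * (1 - p))).
pose T r := delta * mean_hinge2 p (A r) (B r) + r ^+ 2.
have [r0 [r0_gt0 r01 Tr0]] : exists r, [/\ 0 < r, r <= 1 & T r <= 1].
  (* For the lower endpoint, [hinge2 z < 1 / (2 * delta)] bounds the first term of [T] by [1 / 2],
     and [r <= 1 / 2] bounds [r ^+ 2] by [1 / 4]; the other bound on [r] keeps [A r] and [B r] at
     most [z]. *)
  have e0 : 0 < 2^-1 / delta :> R by rewrite divr_gt0.
  have /filter_ex[z ze] := near_hinge2_lt e0.
  pose r := Num.min 2^-1 (2 * delta * m * (Num.min p (1 - p) * hinge1 z)).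
  have mp0 : 0 < Num.min p (1 - p) by rewrite lt_min p0.
  have r_gt0 : 0 < r.
    by rewrite lt_min invr_gt0 ltr0n/= !mulr_gt0 ?hinge1_gt0.
  have r2 : r <= 2^-1 by rewrite ge_min lexx.
  have le_z t : 0 < t -> Num.min p (1 - p) <= t ->
      hinge2 (hinge1_inv (r / (2 * delta * m * t))) <= hinge2 z.
    move=> t0 pt; have ct : 0 < 2 * delta * m * t by rewrite mulr_gt0.
    rewrite hinge2_le -hinge1_le hinge1_invK ?divr_gt0// ler_pdivrMr//.
    rewrite ge_min; apply/orP; right.
    rewrite (mulrC (hinge1 z)) -(mulrA _ t) ler_pM2l//.
    by rewrite ler_pM2r ?hinge1_gt0.
  exists r; split=> //; first by lra.
  have hA : hinge2 (A r) <= hinge2 z by apply: le_z => //; rewrite ge_min lexx.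
  have hB : hinge2 (B r) <= hinge2 z by apply: le_z => //; rewrite ge_min lexx orbT.
  have : delta * mean_hinge2 p (A r) (B r) <= 2^-1.
    rewrite mulrC -ler_pdivlMr// (le_trans _ (ltW ze))// /mean_hinge2; nra.
  rewrite /T; nra.
have T1 : 1 <= T 1.
  by rewrite /T expr1n lerDr mulr_ge0 ?ltW// mean_hinge2_gt0.
have cT : {within `[r0, 1], continuous T}.
  apply: continuous_in_subspaceT => r /[!inE]/=; rewrite in_itv/= => /andP[r0r _].
  have r_gt0 : 0 < r by exact: lt_le_trans r0r.
  have cM (t : R) : 0 < t ->
      {for r, continuous (fun r : R => hinge2 (hinge1_inv (r / (2 * delta * m * t))))}.
    move=> t0; apply: (@continuous_comp _ _ _
      (fun r : R => hinge1_inv (r / (2 * delta * m * t))) hinge2).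
      apply: (@continuous_comp _ _ _ (fun r : R => r / (2 * delta * m * t)) hinge1_inv).
        exact: mulrr_continuous.
      by apply: continuous_hinge1_inv; rewrite divr_gt0// mulr_gt0.
    exact: continuous_hinge2.
  apply: cvgD; last exact: exprn_continuous.
  apply: cvgMr; apply: cvgD; apply: cvgMr; exact: cM.
have [] := @IVT R T r0 1 1 r01 cT.
  by rewrite ge_min Tr0/= le_max T1 orbT.
move=> rho; rewrite in_itv/= => /andP[r0rho _] Trho.
have rho0 : 0 < rho by exact: lt_le_trans r0rho.
exists rho, (A rho), (B rho); split => //.
- rewrite hinge1_invK ?divr_gt0 ?mulr_gt0//.
  by field; rewrite !gt_eqF.
- rewrite hinge1_invK ?divr_gt0 ?mulr_gt0//.
  by field; rewrite !gt_eqF.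
Qed.

(** The constraint function minus [rho / m] times the objective is strictly
    convex and stationary at [(rho, a, b)]. *)
Lemma kkt_gap p m delta rho a b (r x y : R) :
  0 < p < 1 -> 0 < m -> 0 < delta -> kkt p m delta rho a b ->
  (r, x, y) <> (rho, a, b) ->
  rho / m * (x + y + 2 * r * m - (a + b + 2 * rho * m)) <
    delta * mean_hinge2 p x y + r ^+ 2 - 1.
Proof.
move=> /andP[p0 p1] m0 d0 [rho0 ka kb k1] neq.
have q0 : 0 < 1 - p by rewrite subr_gt0.
have ga (z : R) : (delta * p) * (2 * hinge1 a * (z - a)) = rho / m * (z - a).
  by rewrite -ka; field; rewrite gt_eqF.
have gb (z : R) : (delta * (1 - p)) * (2 * hinge1 b * (z - b)) = rho / m * (z - b).
  by rewrite -kb; field; rewrite gt_eqF.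
(* Stationarity cancels the linear terms: what remains are the Taylor remainders of [hinge2] at [a]
   and [b] and a square, and one of the three is positive. *)
have E : delta * mean_hinge2 p x y + r ^+ 2 - 1
    - rho / m * (x + y + 2 * r * m - (a + b + 2 * rho * m))
  = delta * p * (hinge2 x - (hinge2 a + 2 * hinge1 a * (x - a)))
    + delta * (1 - p) * (hinge2 y - (hinge2 b + 2 * hinge1 b * (y - b)))
    + (r - rho) ^+ 2.
  have -> : rho / m * (x + y + 2 * r * m - (a + b + 2 * rho * m))
      = rho / m * (x - a) + rho / m * (y - b) + 2 * rho * (r - rho).
    by field; rewrite gt_eqF.
  by rewrite -ga -gb; move: k1; rewrite /mean_hinge2; lra.
have wx : 0 <= hinge2 x - (hinge2 a + 2 * hinge1 a * (x - a)).
  have [->|/hinge2_gradient/ltW] := eqVneq x a; last by rewrite subr_ge0.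
  by rewrite subrr mulr0 addr0 subrr.
have wy : 0 <= hinge2 y - (hinge2 b + 2 * hinge1 b * (y - b)).
  have [->|/hinge2_gradient/ltW] := eqVneq y b; last by rewrite subr_ge0.
  by rewrite subrr mulr0 addr0 subrr.
have dp : 0 < delta * p by rewrite mulr_gt0.
have dq : 0 < delta * (1 - p) by rewrite mulr_gt0.
rewrite -subr_gt0 E.
have [xa|xa] := eqVneq x a; last first.
  rewrite -addrA ltr_wpDr//; first by rewrite addr_ge0 ?sqr_ge0// mulr_ge0// ltW.
  by rewrite mulr_gt0// subr_gt0 hinge2_gradient.
have [yb|yb] := eqVneq y b; last first.
  rewrite ltr_wpDr ?sqr_ge0// ltr_wpDl//; first by rewrite mulr_ge0// ltW.
  by rewrite mulr_gt0// subr_gt0 hinge2_gradient.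
rewrite ltr_wpDl//; first by rewrite addr_ge0// mulr_ge0// ltW.
rewrite exprn_even_gt0//= subr_eq0; apply/eqP => rr.
by apply: neq; rewrite rr xa yb.
Qed.

Lemma H_kappaE p m tau kappa rho beta : 0 <= p <= 1 ->
  H_kappa p m tau kappa rho beta = (1 - rho ^+ 2)
    / mean_hinge2 p (tau * kappa - rho * m - beta) (kappa - rho * m + beta).
Proof. by move=> p01; rewrite /H_kappa hinge_riskE. Qed.

Lemma feasibleE p m delta tau rho beta kappa : 0 < p < 1 -> 0 < delta ->
  feasible p m delta tau (rho, beta, kappa) <->
  delta * mean_hinge2 p (tau * kappa - rho * m - beta) (kappa - rho * m + beta)
    + rho ^+ 2 - 1 <= 0.
Proof.
move=> p01 d0.
have M0 := mean_hinge2_gt0 (tau * kappa - rho * m - beta)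
  (kappa - rho * m + beta) p01.
have p01' : 0 <= p <= 1 by case/andP: p01 => /ltW -> /ltW ->.
rewrite /feasible H_kappaE// ler_pdivlMr//; split; first by move=> [_]; lra.
have dM := mulr_gt0 d0 M0.
(* As [delta * mean_hinge2] is positive, [h] forces [rho ^+ 2 < 1], whence the bounds on [rho]. *)
move=> h; split; [apply/andP; split; nra|lra].
Qed.

(** At any other feasible point [kkt_gap] makes [(1 + tau) * (ka - kappa)] negative. This gives both
    maximality and uniqueness, so the choice made by [get] is this point. *)
Lemma kkt_solution p m delta tau rho a b :
  0 < p < 1 -> 0 < m -> 0 < delta -> 0 < tau -> kkt p m delta rho a b ->
  let kappa := (a + b + 2 * rho * m) / (1 + tau) in
  solution p m delta tau = (rho, b + rho * m - kappa, kappa).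
Proof.
move=> p01 m0 d0 tau0 K kappa; have [rho0 _ _ k1] := K.
have t1 : 0 < 1 + tau by rewrite addr_gt0.
have rm0 : 0 < rho / m by rewrite divr_gt0.
have kE : (1 + tau) * kappa = a + b + 2 * rho * m.
  by rewrite /kappa; field; rewrite gt_eqF.
have F y : feasible p m delta tau y -> y <> (rho, b + rho * m - kappa, kappa) ->
    y.2 < kappa.
  move: y => [[r be] ka] /feasibleE -/(_ p01 d0) h neq /=.
  have /(kkt_gap p01 m0 d0 K) : (r, tau * ka - r * m - be, ka - r * m + be) <> (rho, a, b).
    move=> [rE aE bE]; apply: neq; rewrite -rE.
    have kk : kappa = ka.
      have : (1 + tau) * kappa = (1 + tau) * ka by rewrite kE -rE -aE -bE; ring.
      by move/mulfI; apply; rewrite gt_eqF.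
    by rewrite kk -bE; congr (_, _, _); ring.
  move=> /lt_le_trans/(_ h); rewrite pmulr_rlt0// -kE.
  rewrite (_ : _ - _ = (1 + tau) * (ka - kappa)); last by ring.
  by rewrite pmulr_rlt0// subr_lt0.
have S : is_solution p m delta tau (rho, b + rho * m - kappa, kappa).
  split.
    apply/feasibleE => //.
    rewrite (_ : tau * kappa - rho * m - (b + rho * m - kappa) = a); last first.
      rewrite (_ : _ - _ = (1 + tau) * kappa - 2 * rho * m - b); last by ring.
      by rewrite kE; ring.
    rewrite (_ : kappa - rho * m + (b + rho * m - kappa) = b); last by ring.
    by rewrite k1 subrr.
  move=> y fy; have [->//|neq] := pselect (y = (rho, b + rho * m - kappa, kappa)).
  by rewrite ltW//= F.
rewrite /solution; case: xgetP => [x _ [fx mx]|/(_ _ S)//].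
apply: contrapT => neq.
by have := F _ fx neq; rewrite ltNge; have := mx _ S.1 => /= ->.
Qed.

(** Since [delta < delta_star p m 1 0], some point with [kappa = 0] satisfies the constraint
    strictly. The objective is [0] there, so [kkt_gap] makes the optimal one positive. *)
Lemma kkt_objective_gt0 p m delta rho a b :
  0 < p < 1 -> 0 < m -> 0 < delta -> delta < delta_star p m 1 0 ->
  kkt p m delta rho a b -> 0 < a + b + 2 * rho * m.
Proof.
move=> p01 m0 d0 dstar K; have [rho0 _ _ k1] := K.
have p01' : 0 <= p <= 1 by case/andP: p01 => /ltW -> /ltW ->.
move: dstar; rewrite /delta_star /maximum.
case: xgetP => [H -> [[r [be [_ HE]]] _]|_]; last first.
  (* If there is no maximum, then [delta_star] is the default value [0]. *)
  by rewrite ltNge; move/negP; case; exact: ltW.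
rewrite HE H_kappaE// !mulr0 !sub0r => dH.
have M0 := mean_hinge2_gt0 (- (r * m) - be) (- (r * m) + be) p01.
move: dH; rewrite ltr_pdivlMr// => dH.
have /(kkt_gap p01 m0 d0 K) : (r, - (r * m) - be, - (r * m) + be) <> (rho, a, b).
  by move=> [rE aE bE]; move: dH k1; rewrite aE bE rE; lra.
move=> gap.
have : rho / m * (- (a + b + 2 * rho * m)) < 0.
  apply: le_lt_trans (_ : delta * mean_hinge2 p (- (r * m) - be) (- (r * m) + be)
    + r ^+ 2 - 1 < 0); last by lra.
  apply/ltW; apply: le_lt_trans gap; rewrite le_eqVlt; apply/orP; left; apply/eqP.
  by congr (_ * _); ring.
by rewrite pmulr_rlt0 ?divr_gt0// oppr_lt0.
Qed.

(** * The balanced error as a function of [beta], and the optimal [tau] *)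

Lemma Phi_sym_lt (c x y : R) : 0 < c -> 0 <= x -> x < y ->
  Phi (- c - x) + Phi (- c + x) < Phi (- c - y) + Phi (- c + y).
Proof.
move=> c0 x0 xy; pose f (t : R) := Phi (- c + - t) + Phi (- c + t).
apply: (@derive_gt0_lt _ f (fun t => phi (- c + t) - phi (- c - t)) _ _ xy).
  move=> z _.
  have H1 : is_derive z 1 (fun t => Phi (- c - t) : R) (- phi (- c - z)).
    have H : is_derive z 1 (fun t : R => - c - t) (- 1).
      by apply: is_derive_eq; rewrite add0r mul1r.
    have := @is_derive1_comp R (@Phi R) (fun t => - c - t) z _ _ (is_derive_Phi _) H.
    by rewrite mulrN1.
  have H2 : is_derive z 1 (fun t => Phi (- c + t) : R) (phi (- c + z)).
    have H : is_derive z 1 (fun t : R => - c + t) 1.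
      by apply: is_derive_eq; rewrite add0r mul1r.
    have := @is_derive1_comp R (@Phi R) (fun t => - c + t) z _ _ (is_derive_Phi _) H.
    by rewrite mulr1.
  by apply: is_derive_eq; rewrite addrC.
(* For [c, z > 0], [- c + z] is closer to [0] than [- c - z], so the density is larger there. *)
move=> z /andP[xz _]; rewrite subr_gt0 !phiE ltr_pM2l ?normal_peak_gt0 ?oner_neq0//.
by rewrite ltr_expR; nra.
Qed.

Lemma Err_balE p m delta tau : Err_bal p m delta tau =
  2^-1 * (Phi (- (rho_star p m delta tau * m) - `|beta_star p m delta tau|)
          + Phi (- (rho_star p m delta tau * m) + `|beta_star p m delta tau|)).
Proof.
rewrite /Err_bal /Err_plus /Err_minus mulNr -mulrDr.
have [_|_] := ger0P (beta_star p m delta tau) => //.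
by rewrite opprK addrC.
Qed.

(** The balanced error is even and strictly increasing in [`|beta|], so a
    [tau] with [beta != 0] is improved by one that moves [beta] towards [0]. *)
Lemma kkt_beta_tau_opt p m delta tau rho a b :
  0 < p < 1 -> 0 < m -> 0 < delta -> delta < delta_star p m 1 0 ->
  is_tau_opt p m delta tau -> kkt p m delta rho a b ->
  beta_star p m delta tau = 0.
Proof.
move=> p01 m0 d0 dstar [tau0 topt] K.
have K0 := kkt_objective_gt0 p01 m0 d0 dstar K.
have rho0 : 0 < rho by case: K.
set k := a + b + 2 * rho * m in K0.
pose B := b + rho * m.
have rhoE t : 0 < t -> rho_star p m delta t = rho.
  by move=> t0; rewrite /rho_star (kkt_solution p01 m0 d0 t0 K).
have betaE t : 0 < t -> beta_star p m delta t = B - k / (1 + t).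
  by move=> t0; rewrite /beta_star (kkt_solution p01 m0 d0 t0 K).
(* As [t] runs over the positive reals, [B - k / (1 + t)] sweeps [(B - k, B)]; the [t] below attains
   [x]. Here [k > 0] is essential. *)
have reach (x : R) : B - k < x -> x < B -> `|beta_star p m delta tau| <= `|x|.
  move=> kx xB; pose t := k / (B - x) - 1.
  have Bx : 0 < B - x by rewrite subr_gt0.
  have t0 : 0 < t by rewrite subr_gt0 ltr_pdivlMr// mul1r; lra.
  have := topt _ t0; rewrite !Err_balE !rhoE// ler_pM2l ?invr_gt0//.
  have -> : beta_star p m delta t = x.
    rewrite betaE// (_ : 1 + t = k / (B - x)); last by rewrite /t; ring.
    by field; rewrite !gt_eqF.
  rewrite !leNgt; apply: contra => /Phi_sym_lt; apply; last by [].
  by rewrite mulr_gt0.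
set be := beta_star p m delta tau in reach *.
have kt : 0 < k / (1 + tau) by rewrite divr_gt0// addr_gt0.
have kt1 : k / (1 + tau) < k by rewrite ltr_pdivrMr ?addr_gt0//; nra.
have beE : be = B - k / (1 + tau) by rewrite /be betaE.
have [be0|be0|//] := ltrgtP be 0; exfalso.
(* The value [0] may lie outside [(B - k, B)], so the competitor is the midpoint of [be] and the
   nearer of [0] and the endpoint: it is attained and smaller in absolute value. *)
- have := reach ((be + Num.min 0 B) / 2).
  have : Num.min 0 B <= 0 by rewrite ge_min lexx.
  have : Num.min 0 B <= B by rewrite ge_min lexx orbT.
  have : be < Num.min 0 B by rewrite lt_min be0/=; lra.
  set M := Num.min 0 B => h1 h2 h3 h4.
  by have := h4 ltac:(lra) ltac:(lra); rewrite !ltr0_norm//; lra.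
- have := reach ((be + Num.max 0 (B - k)) / 2).
  have : 0 <= Num.max 0 (B - k) by rewrite le_max lexx.
  have : B - k <= Num.max 0 (B - k) by rewrite le_max lexx orbT.
  have : Num.max 0 (B - k) < be by rewrite gt_max be0/=; lra.
  set M := Num.max 0 _ => h1 h2 h3 h4.
  by have := h4 ltac:(lra) ltac:(lra); rewrite !gtr0_norm//; lra.
Qed.

Lemma admissible_kkt p m delta : admissible p m delta ->
  exists rho a b, kkt p m delta rho a b /\
   [/\ Err_plus_opt p m delta = Phi (- (rho * m)),
       Err_minus_opt p m delta = Phi (- (rho * m))
     & Err_bal_opt p m delta = Phi (- (rho * m))].
Proof.
move=> [/andP[p0 p2] m0 d0 dstar [tau' tauP]].
have p01 : 0 < p < 1 by rewrite p0 (lt_trans p2)// invf_lt1// ltr1n.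
have [rho [a [b K]]] := kkt_exists p01 m0 d0.
exists rho, a, b; split => //.
have : is_tau_opt p m delta (tau_opt p m delta).
  by rewrite /tau_opt; case: xgetP => // /(_ _ tauP).
set tau := tau_opt p m delta => tP; have t0 : 0 < tau by case: tP.
have rE : rho_star p m delta tau = rho.
  by rewrite /rho_star (kkt_solution p01 m0 d0 t0 K).
have bE := kkt_beta_tau_opt p01 m0 d0 dstar tP K.
have E1 : Err_plus p m delta tau = Phi (- (rho * m)).
  by rewrite /Err_plus rE bE subr0 mulNr.
have E2 : Err_minus p m delta tau = Phi (- (rho * m)).
  by rewrite /Err_minus rE bE addr0 mulNr.
by split => //; rewrite /Err_bal_opt /Err_bal -/tau E1 E2; field.
Qed.

(** * Growth of [rho * m] in each parameter *)

Lemma kkt_rho_m_incr_delta p m delta delta' rho a b rho' a' b' :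
  0 < p < 1 -> 0 < m -> 0 < delta -> delta < delta' ->
  kkt p m delta rho a b -> kkt p m delta' rho' a' b' -> rho * m < rho' * m.
Proof.
move=> /andP[p0 p1] m0 d0 dd [r0 ka kb k1] [r0' ka' kb' k1'].
have q0 : 0 < 1 - p by rewrite subr_gt0.
rewrite ltr_pM2r// ltNge; apply/negP => rr.
have d0' := lt_trans d0 dd.
have mono q x y : 0 < q -> 2 * delta * m * (q * hinge1 x) = rho ->
    2 * delta' * m * (q * hinge1 y) = rho' -> hinge2 y / hinge1 y < hinge2 x / hinge1 x.
  move=> q_gt0 hx hy; apply: hinge2_div_hinge1_incr; rewrite -hinge1_lt ltNge.
  apply/negP => xy; move: rr; apply/negP; rewrite -ltNge -hx -hy.
  have h := hinge1_gt0 x.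
  apply: lt_le_trans (_ : 2 * delta' * m * (q * hinge1 x) <= _).
    by rewrite !ltr_pM2r ?mulr_gt0// ltr_pM2l.
  by rewrite ler_pM2l ?mulr_gt0// ler_pM2l.
(* The gradient equations absorb the factor [d], whose growth opposes the decrease of [hinge2]. If
   [rho' <= rho], both [rho] and the ratios [hinge2 / hinge1] fail to grow, the ratios strictly
   decreasing, yet the total stays [1]. *)
have mean_hinge2E d r x y : 2 * d * m * (p * hinge1 x) = r ->
    2 * d * m * ((1 - p) * hinge1 y) = r ->
    d * mean_hinge2 p x y = r / (2 * m) * (hinge2 x / hinge1 x + hinge2 y / hinge1 y).
  move=> hx hy; rewrite (mulrDr (r / _)) -{1}hx -hy /mean_hinge2.
  by field; rewrite !gt_eqF ?hinge1_gt0.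
move: (etrans k1' (esym k1)); rewrite (mean_hinge2E _ _ _ _ ka kb) (mean_hinge2E _ _ _ _ ka' kb').
have lta := mono _ _ _ p0 ka ka'; have ltb := mono _ _ _ q0 kb kb'.
have s0 : 0 < hinge2 a' / hinge1 a' + hinge2 b' / hinge1 b'.
  by rewrite addr_gt0// divr_gt0 ?hinge1_gt0 ?hinge2_gt0.
set s := _ + _ in s0 *; set s' := hinge2 a / _ + _.
have ss : s < s' by rewrite ltrD.
apply/eqP; rewrite lt_eqF//; apply: ltr_leD; last by rewrite lerXn2r// ?nnegrE ltW.
apply: (@lt_le_trans _ _ (rho' / (2 * m) * s')).
  by rewrite ltr_pM2l// divr_gt0// mulr_gt0.
by rewrite ler_pM2r ?(lt_trans s0)// ler_pM2r// invr_gt0 mulr_gt0.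
Qed.

(** If [rho * m] did not grow, [rho] would drop, and so would [hinge1 a = rho / (2 * delta * m * p)]
    and its analogue for [b]. Every term of the constraint would decrease while the sum stays
    [1]. *)
Lemma kkt_rho_m_incr_m p m m' delta rho a b rho' a' b' :
  0 < p < 1 -> 0 < m -> 0 < delta -> m < m' ->
  kkt p m delta rho a b -> kkt p m' delta rho' a' b' -> rho * m < rho' * m'.
Proof.
move=> /andP[p0 p1] m0 d0 mm [r0 ka kb k1] [r0' ka' kb' k1'].
have q0 : 0 < 1 - p by rewrite subr_gt0.
have m0' := lt_trans m0 mm.
rewrite ltNge; apply/negP => cc.
have rr : rho' < rho by rewrite ltNge; apply/negP => rr; nra.
have mono q x y : 0 < q -> 2 * delta * m * (q * hinge1 x) = rho ->
    2 * delta * m' * (q * hinge1 y) = rho' -> hinge2 y < hinge2 x.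
  move=> q_gt0 hx hy; apply: hinge2_incr; rewrite -hinge1_lt ltNge.
  apply/negP => xy; move: rr; apply/negP; rewrite -leNgt -hx -hy.
  have h := hinge1_gt0 x.
  apply: (@le_trans _ _ (2 * delta * m' * (q * hinge1 x))).
    by rewrite ler_pM2r ?mulr_gt0// ler_pM2l ?mulr_gt0// ltW.
  by rewrite ler_pM2l ?mulr_gt0// ler_pM2l.
have lta := mono _ _ _ p0 ka ka'; have ltb := mono _ _ _ q0 kb kb'.
move: (etrans k1' (esym k1)); apply/eqP; rewrite lt_eqF//.
apply: ltrD; last by rewrite ltrXn2r// ?nnegrE ltW.
by rewrite ltr_pM2l// ltrD// ltr_pM2l.
Qed.

(** [p |-> p * h(k / p) + (1 - p) * h(k / (1 - p))] with [h = hinge2 \o hinge1^-1]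
    decreases on [(0, 1/2)], because the perspective of the convex [h] is convex. *)
Lemma mean_hinge2_decr p p' k a b a' b' :
  0 < p -> p < p' -> p' < 2^-1 -> 0 < k ->
  p * hinge1 a = k -> (1 - p) * hinge1 b = k ->
  p' * hinge1 a' = k -> (1 - p') * hinge1 b' = k ->
  mean_hinge2 p' a' b' < mean_hinge2 p a b.
Proof.
move=> p0 pp p2 k0 ha hb ha' hb'.
have ba : b' < a'.
  rewrite -hinge1_lt ltNge; apply/negP => ab.
  have := hinge1_gt0 a'; nra.
have aa : a != a'.
  by apply/eqP => aa; move: ha; rewrite aa -ha'; have := hinge1_gt0 a'; nra.
have bb : b != b'.
  by apply/eqP => bb; move: hb; rewrite bb -hb'; have := hinge1_gt0 b'; nra.
have ta := hinge2_tangent aa; have tb := hinge2_tangent bb.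
have q0 : 0 < 1 - p by lra.
have := hinge_dual_incr ba; rewrite /hinge_dual => W.
set ra := 2 * hinge1 a' / Phi a' in ta; set rb := 2 * hinge1 b' / Phi b' in tb.
have Wa : 2 * hinge1 a' ^+ 2 / Phi a' = ra * hinge1 a'.
  by rewrite /ra; field; rewrite gt_eqF ?Phi_gt0.
have Wb : 2 * hinge1 b' ^+ 2 / Phi b' = rb * hinge1 b'.
  by rewrite /rb; field; rewrite gt_eqF ?Phi_gt0.
rewrite Wa Wb in W.
have {}ta : p * hinge2 a' + ra * ((p' - p) * hinge1 a') < p * hinge2 a.
  have -> : (p' - p) * hinge1 a' = p * (hinge1 a - hinge1 a').
    by rewrite mulrBl ha' mulrBr ha.
  by rewrite mulrCA -mulrDr ltr_pM2l.
have {}tb : (1 - p) * hinge2 b' + rb * ((p - p') * hinge1 b') < (1 - p) * hinge2 b.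
  have -> : (p - p') * hinge1 b' = (1 - p) * (hinge1 b - hinge1 b').
    by rewrite mulrBr hb -hb'; ring.
  by rewrite mulrCA -mulrDr ltr_pM2l.
rewrite /mean_hinge2.
(* The brackets are [hinge_dual a'] and [hinge_dual b'], with [b' < a'] because [p' < 1 / 2]. The
   two tangent inequalities at [a'] and [b'] add up to a decrease exceeding this product. *)
have : 0 < (p' - p) * ((ra * hinge1 a' - hinge2 a') - (rb * hinge1 b' - hinge2 b')).
  by rewrite mulr_gt0// subr_gt0.
lra.
Qed.

(** Two stages, under the assumption [rho' <= rho]: moving [p] to [p'] at fixed [rho], which leads
    to the auxiliary [x] and [y], strictly lowers [mean_hinge2]; passing from [rho] to [rho'] does
    not raise it. The constraint cannot then still equal [1]. *)
Lemma kkt_rho_m_incr_p p p' m delta rho a b rho' a' b' :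
  0 < p -> p < p' -> p' < 2^-1 -> 0 < m -> 0 < delta ->
  kkt p m delta rho a b -> kkt p' m delta rho' a' b' -> rho * m < rho' * m.
Proof.
move=> p0 pp p2 m0 d0 [r0 ka kb k1] [r0' ka' kb' k1'].
have c0 : 0 < 2 * delta * m by rewrite !mulr_gt0.
have q0 : 0 < 1 - p' by lra.
have p0' : 0 < p' by lra.
rewrite ltr_pM2r// ltNge; apply/negP => rr.
pose k := rho / (2 * delta * m).
have k0 : 0 < k by rewrite divr_gt0.
have [x xk] : exists x, hinge1 x = k / p' by apply: hinge1_surj; rewrite divr_gt0.
have [y yk] : exists y, hinge1 y = k / (1 - p') by apply: hinge1_surj; rewrite divr_gt0.
have hx : p' * hinge1 x = k by rewrite xk; field; rewrite gt_eqF.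
have hy : (1 - p') * hinge1 y = k by rewrite yk; field; rewrite gt_eqF.
have hk t : 2 * delta * m * t = rho -> t = k.
  by rewrite /k => <-; field; rewrite !gt_eqF.
have lt1 := mean_hinge2_decr p0 pp p2 k0 (hk _ ka) (hk _ kb) hx hy.
have mono q z w : 0 < q -> q * hinge1 w = k -> 2 * delta * m * (q * hinge1 z) = rho' ->
    hinge2 z <= hinge2 w.
  move=> q_gt0 hw hz; rewrite hinge2_le -hinge1_le.
  rewrite -(ler_pM2l q_gt0) hw -(ler_pM2l c0) hz.
  by rewrite (_ : _ * k = rho)// /k; field; rewrite !gt_eqF.
have lea := mono _ _ _ p0' hx ka'; have leb := mono _ _ _ q0 hy kb'.
have lt2 : mean_hinge2 p' a' b' <= mean_hinge2 p' x y.
  by rewrite lerD// ler_wpM2l// ltW.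
move: (etrans k1' (esym k1)); apply/eqP; rewrite lt_eqF//.
apply: ltr_leD; last by rewrite lerXn2r// ?nnegrE ltW.
by rewrite ltr_pM2l// (le_lt_trans lt2).
Qed.

End Optimum.

(** At the optimal [tau] the three errors share the value [Phi (- (rho * m))], so one argument for
    an abstract [E] serves them all. *)
Lemma decreasing_in_each_Phi {R : realType} (E : R -> R -> R -> R) :
  (forall p m delta, admissible p m delta -> exists rho a b,
    kkt p m delta rho a b /\ E p m delta = Phi (- (rho * m))) ->
  decreasing_in_each E.
Proof.
move=> EP; split.
- move=> m delta p p' /= A A' pp.
  have [rho [a [b [K ->]]]] := EP _ _ _ A.
  have [rho' [a' [b' [K' ->]]]] := EP _ _ _ A'.
  case: A A' => [/andP[p0 _] m0 d0 _ _] [/andP[_ p2] _ _ _ _].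
  by apply: Phi_incr; rewrite ltrN2; exact: kkt_rho_m_incr_p K K'.
- move=> p m delta delta' /= A A' dd.
  have [rho [a [b [K ->]]]] := EP _ _ _ A.
  have [rho' [a' [b' [K' ->]]]] := EP _ _ _ A'.
  case: A => [/andP[p0 p2] m0 d0 _ _].
  apply: Phi_incr; rewrite ltrN2; apply: kkt_rho_m_incr_delta K K' => //.
  by rewrite p0 (lt_trans p2)// invf_lt1// ltr1n.
- move=> p delta m m' /= A A' mm.
  have [rho [a [b [K ->]]]] := EP _ _ _ A.
  have [rho' [a' [b' [K' ->]]]] := EP _ _ _ A'.
  case: A => [/andP[p0 p2] m0 d0 _ _].
  apply: Phi_incr; rewrite ltrN2; apply: kkt_rho_m_incr_m K K' => //.
  by rewrite p0 (lt_trans p2)// invf_lt1// ltr1n.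
Qed.

Theorem proposition5p4 (R : realType) :
  [/\ decreasing_in_each (@Err_plus_opt R),
      decreasing_in_each (@Err_minus_opt R)
    & decreasing_in_each (@Err_bal_opt R)].
Proof.
split; apply: decreasing_in_each_Phi => p m delta /admissible_kkt;
  by move=> [rho [a [b [K [E1 E2 E3]]]]]; exists rho, a, b.
Qed.
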